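(* Let $K/F$ be a cyclic Galois field extension of degree $n\geq 3$, let $m>1$ be an integer with $n\geq m-1$, and let $\varphi$ be the Euler function. Then there are $\varphi(n)$ different classes of proper Petit algebras of type $K[t;\sigma_i]/K[t;\sigma_i](t^m-a)$ with $a\in K\setminus F$, one class for each choice of generator $\sigma_i$ of $\mathrm{Gal}(K/F)$. Algebras in two different classes (i.e. constructed from two different generators of $\mathrm{Gal}(K/F)$) are not isomorphic.
   Context: $K[t;\sigma]$ is the twisted polynomial ring with $tc=\sigma(c)t$ for $c\in K$. For $f\in R=K[t;\sigma]$ of degree $m>1$, the Petit algebra $R/Rf$ is the set of polynomials of degree $<m$ with product $g\circ h$ equal to the remainder $r$ in the right division $gh=qf+r$, $\deg r<m$; for $\sigma$ a generator of $\mathrm{Gal}(K/F)$ it is a unital $F$-algebra of dimension $mn$. It is called proper if it is not associative. Isomorphism means isomorphism of $F$-algebras. *)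

(* Defs.v *)
From HB Require Import structures.
From mathcomp Require Import all_boot all_order all_fingroup all_algebra.
From mathcomp Require Import all_solvable all_field zify.

Set Implicit Arguments.
Unset Strict Implicit.
Unset Printing Implicit Defensive.

Import GRing.Theory.
Local Open Scope ring_scope.

(* Not necessarily associative, not necessarily unital algebras over F.       *)
Record naAlg (F : fieldType) := NAAlg {
  na_sort :> lmodType F;
  na_mul : na_sort -> na_sort -> na_sort;
  na_mul_linearl : forall y, linear (na_mul^~ y);
  na_mul_linearr : forall x, linear (na_mul x)
}.

Definition na_proper (F : fieldType) (A : naAlg F) : Prop :=
  ~ associative (@na_mul F A).

(* For unital algebras such a map automatically preserves the unit.           *)
Definition na_isomorphic (F : fieldType) (A B : naAlg F) : Prop :=
  exists G : {linear A -> B},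
    bijective G /\ {morph G : x y / na_mul x y >-> na_mul x y}.

(* K[t; s]: the additive group is that of {poly K}, with coefficients on the  *)
(* left and t being 'X; the product is (c t^i) (d t^j) = c s^i(d) t^(i + j).  *)
Definition skew_poly (F : fieldType) (K : fieldExtType F) (s : 'AEnd(K)) :=
  {poly K}.

Section SkewPoly.

Variables (F : fieldType) (K : fieldExtType F) (s : 'AEnd(K)).
Implicit Types (p q r f g : skew_poly s).

HB.instance Definition _ := GRing.Zmodule.copy (skew_poly s) {poly K}.

Definition skew_mul p q : skew_poly s :=
  \poly_(k < (size p + size q).-1)
    \sum_(i < k.+1) p`_i * iter i s q`_(k - i).

Definition skew_one : skew_poly s := 1%:P.

Fact iter_is_zmod_morphism i : zmod_morphism (iter i s).
Proof. by elim: i => [//|i IH] x y /=; rewrite IH rmorphB. Qed.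

Fact iter_is_monoid_morphism i : monoid_morphism (iter i s).
Proof.
elim: i => [//|i [IH1 IHM]]; split=> [|x y] /=; first by rewrite IH1 rmorph1.
by rewrite IHM rmorphM.
Qed.

HB.instance Definition _ i :=
  GRing.isZmodMorphism.Build K K (iter i s) (iter_is_zmod_morphism i).
HB.instance Definition _ i :=
  GRing.isMonoidMorphism.Build K K (iter i s) (iter_is_monoid_morphism i).

Lemma coef_skew_mul p q k :
  (skew_mul p q)`_k = \sum_(i < k.+1) p`_i * iter i s q`_(k - i).
Proof.
rewrite coef_poly -subn1 ltn_subRL add1n; case: leqP => // le_pq_k.
rewrite big1 // => i _; have [lt_i_p | ge_i] := ltnP i (size p); last first.
  by rewrite nth_default // mul0r.
rewrite [q`_ _]nth_default ?rmorph0 ?mulr0 //.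
by rewrite leq_subRL ?leq_ord // -ltnS (leq_trans _ le_pq_k) // -addSn leq_add2r.
Qed.

Lemma coef_skew_mul_rev p q k :
  (skew_mul p q)`_k = \sum_(i < k.+1) p`_(k - i) * iter (k - i) s q`_i.
Proof.
rewrite coef_skew_mul (reindex_inj rev_ord_inj) /=.
by apply: eq_bigr => i _; rewrite (sub_ordK i).
Qed.

Fact skew_mulA : associative skew_mul.
Proof.
move=> p q r; apply/polyP=> i; rewrite coef_skew_mul coef_skew_mul_rev.
pose coef3 j k :=
  p`_j * (iter j s q`_(i - j - k) * iter (i - k) s r`_k).
transitivity (\sum_(j < i.+1) \sum_(k < i.+1 | (k <= i - j)%N) coef3 j k).
  apply: eq_bigr => /= j _.
  rewrite coef_skew_mul_rev rmorph_sum big_distrr /=.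
  rewrite (big_ord_narrow_leq (leq_subr _ _)); apply: eq_bigr => k _ /=.
  rewrite /coef3 rmorphM /= -iterD; congr (_ * (_ * iter _ _ _)).
  by move: (ltn_ord k) (ltn_ord j); lia.
rewrite (exchange_big_dep predT) //=; apply: eq_bigr => k _.
transitivity (\sum_(j < i.+1 | (j <= i - k)%N) coef3 j k).
  by apply: eq_bigl => j; move: (ltn_ord k) (ltn_ord j); lia.
rewrite (big_ord_narrow_leq (leq_subr _ _)) coef_skew_mul big_distrl /=.
by apply: eq_bigr => j _; rewrite /coef3 subnAC mulrA.
Qed.

Fact skew_mul1p : left_id skew_one skew_mul.
Proof.
move=> p; apply/polyP => i; rewrite coef_skew_mul big_ord_recl subn0 /=.
by rewrite big1 => [|j _]; rewrite coefC /= ?mul1r ?addr0 ?mul0r.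
Qed.

Fact skew_mulp1 : right_id skew_one skew_mul.
Proof.
move=> p; apply/polyP => i; rewrite coef_skew_mul_rev big_ord_recl subn0.
rewrite big1 => [|j _]; first by rewrite coefC /= rmorph1 mulr1 addr0.
by rewrite coefC /= rmorph0 mulr0.
Qed.

Fact skew_mulDl : left_distributive skew_mul +%R.
Proof.
move=> p q r; apply/polyP=> i; rewrite coefD !coef_skew_mul -big_split.
by apply: eq_bigr => j _; rewrite coefD mulrDl.
Qed.

Fact skew_mulDr : right_distributive skew_mul +%R.
Proof.
move=> p q r; apply/polyP=> i; rewrite coefD !coef_skew_mul -big_split.
by apply: eq_bigr => j _; rewrite coefD rmorphD mulrDr.
Qed.

Fact skew_one_neq0 : skew_one != 0.
Proof. exact: (oner_neq0 {poly K}). Qed.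

HB.instance Definition _ := GRing.Zmodule_isNzRing.Build (skew_poly s)
  skew_mulA skew_mul1p skew_mulp1 skew_mulDl skew_mulDr skew_one_neq0.

Definition skewC (c : K) : skew_poly s := c%:P.
Definition skewt : skew_poly s := 'X.

Lemma coef_skewM p q k :
  (p * q)`_k = \sum_(i < k.+1) p`_i * iter i s q`_(k - i).
Proof. exact: coef_skew_mul. Qed.

Lemma coef_skewCM c p k : (skewC c * p)`_k = c * p`_k.
Proof.
rewrite coef_skewM big_ord_recl subn0 coefC /=.
by rewrite big1 ?addr0 // => j _; rewrite coefC mul0r.
Qed.

Lemma coef_skewXnM i q k :
  (('X^i : skew_poly s) * q)`_k = if (i <= k)%N then iter i s q`_(k - i) else 0.
Proof.
rewrite coef_skewM; case: leqP => [le_ik | lt_ki].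
  rewrite (bigD1 (Ordinal (le_ik : i < k.+1)%N)) //= coefXn eqxx mul1r.
  rewrite big1 ?addr0 // => j ne_ji; rewrite coefXn.
  by case: eqP => [ji | _]; [case/eqP: ne_ji; apply/val_inj | rewrite mul0r].
rewrite big1 // => j _; rewrite coefXn.
case: eqP => [ji | _]; last by rewrite mul0r.
by move: (ltn_ord j); rewrite ji ltnS leqNgt lt_ki.
Qed.

Lemma skewtC (c : K) : skewt * skewC c = skewC (s c) * skewt.
Proof.
apply/polyP=> k; rewrite coef_skewCM /skewt -['X]expr1 coef_skewXnM.
rewrite coefC coefXn; case: k => [|[|k]] /=; rewrite ?mulr0 ?mulr1 //.
by rewrite rmorph0.
Qed.

Lemma skewtX n : skewt ^+ n = 'X^n :> {poly K}.
Proof.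
elim: n => [|n IHn]; first by rewrite !expr0.
rewrite exprSr; apply/polyP=> k; rewrite {}[skewt ^+ n]IHn coef_skewXnM.
rewrite !coefXn coefX; case: leqP => [le_nk | lt_kn]; last first.
  by rewrite (ltn_eqF (ltnW lt_kn : (k < n.+1)%N)).
by rewrite rmorph_nat; congr (nat_of_bool _)%:R; move: le_nk; lia.
Qed.

(* Division on the right by f, g = q f + r with deg r < deg f: while          *)
(* deg f <= deg g, subtract (c t^d) f with leading term that of g.            *)
Fixpoint skew_edivp_rec f (n : nat) q r : skew_poly s * skew_poly s :=
  if n isn't n1.+1 then (q, r) else
  if (size r < size f)%N then (q, r) else
  let d := (size r - size f)%N in
  let u : skew_poly s := skewC (lead_coef r / iter d s (lead_coef f)) * skewt ^+ d in
  skew_edivp_rec f n1 (q + u) (r - u * f).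

Definition skew_edivp g f := skew_edivp_rec f (size g) 0 g.
Definition skew_divp g f := (skew_edivp g f).1.
Definition skew_modp g f := (skew_edivp g f).2.

Lemma skew_divp_eq g f : g = skew_divp g f * f + skew_modp g f.
Proof.
suff rec_eq n q r : let qr := skew_edivp_rec f n q r in
    qr.1 * f + qr.2 = q * f + r.
  by rewrite /skew_divp /skew_modp /skew_edivp rec_eq mul0r add0r.
elim: n q r => [//|n IHn] q r /=; case: ifP => // _.
by rewrite IHn mulrDl -addrA addrC [r - _]addrC addNKr addrC.
Qed.

Lemma size_skew_modp g f : f != 0 -> (size (skew_modp g f) < size f)%N.
Proof.
move=> nz_f; have f_gt0: (0 < size f)%N by rewrite size_poly_gt0.
suff rec_lt n q r : (size r <= n)%N ->
  (size (skew_edivp_rec f n q r).2 < size f)%N by apply: rec_lt.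
elim: n q r => [|n IHn] q r /= le_r_n; first exact: leq_ltn_trans f_gt0.
case: (ltnP (size r) (size f)) => // le_f_r; apply: IHn.
have r_gt0 := leq_trans f_gt0 le_f_r.
set d := (size r - size f)%N; have def_r: (d + size f)%N = size r by apply: subnK.
apply/leq_sizeP => k le_nk; rewrite coefB -mulrA coef_skewCM skewtX coef_skewXnM.
have [le_r_k | lt_k_r] := leqP (size r) k.
  have le_dk: (d <= k)%N by apply: leq_trans le_r_k; apply: leq_subr.
  rewrite [r`_k]nth_default // [f`_ _]nth_default; last first.
    by rewrite leq_subRL // def_r.
  by rewrite rmorph0 if_same mulr0 subr0.
have def_k: k = (size r).-1.
  apply/eqP; rewrite eqn_leq -ltnS prednK // lt_k_r -ltnS prednK //.
  exact: leq_trans le_r_n _.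
have def_kd: (k = d + (size f).-1)%N by rewrite def_k -def_r -!subn1 addnBA.
rewrite {2 3}def_kd leq_addr addKn.
rewrite def_k -!/(lead_coef _) divfK ?subrr // fmorph_eq0.
by rewrite lead_coef_eq0.
Qed.

Lemma lead_skewM p q :
  (p * q)`_(size p + size q).-2 = lead_coef p * iter (size p).-1 s (lead_coef q).
Proof.
rewrite coef_skewM; have [->|nz_p] := eqVneq p 0.
  by rewrite lead_coef0 mul0r big1 // => i _; rewrite coef0 mul0r.
have [->|nz_q] := eqVneq q 0.
  rewrite lead_coef0 rmorph0 mulr0 big1 // => i _.
  by rewrite coef0 rmorph0 mulr0.
have p_gt0: (0 < size p)%N by rewrite size_poly_gt0.
have q_gt0: (0 < size q)%N by rewrite size_poly_gt0.
have lt_nat a b : (0 < a)%N -> (0 < b)%N -> (a.-1 < (a + b).-2.+1)%N by lia.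
have eq_nat a b : (0 < a)%N -> (0 < b)%N -> ((a + b).-2 - a.-1 = b.-1)%N by lia.
have ge_nat a b i :
  (i < (a + b).-2.+1)%N -> (i < a)%N -> i != a.-1 -> (b <= (a + b).-2 - i)%N.
  by lia.
rewrite (bigD1 (Ordinal (lt_nat _ _ p_gt0 q_gt0))) //= big1 => [|i ne_i].
  by rewrite addr0 eq_nat.
have [le_p_i | lt_i_p] := leqP (size p) i; first by rewrite nth_default ?mul0r.
by rewrite [q`_ _]nth_default ?rmorph0 ?mulr0 //; apply: ge_nat.
Qed.

Lemma skew_modp_uniq g f q r :
  g = q * f + r -> (size r < size f)%N -> skew_modp g f = r.
Proof.
move=> def_g lt_rf; have nz_f: f != 0.
  by apply: contraTneq lt_rf => ->; rewrite size_poly0.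
have lt_mf := size_skew_modp g nz_f.
pose u := skew_divp g f - q; pose v := r - skew_modp g f.
have def_v: u * f = v.
  have /eqP := skew_divp_eq g f; rewrite {1}def_g => /eqP def_qr.
  rewrite /u /v mulrBl; apply/eqP.
  by rewrite subr_eq addrAC eq_sym subr_eq addrC def_qr.
have lt_vf: (size v < size f)%N.
  by rewrite (leq_ltn_trans (size_polyD _ _)) // size_polyN gtn_max lt_rf.
have u0: u = 0.
  apply/eqP; apply: contraTT lt_vf => nz_u; rewrite -leqNgt -def_v.
  have u_gt0: (0 < size u)%N by rewrite size_poly_gt0.
  have le_nat a b : (0 < a)%N -> (b <= (a + b).-2.+1)%N by lia.
  apply: leq_trans (le_nat _ _ u_gt0) _.
  rewrite ltnNge; apply/negP => /(nth_default 0).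
  rewrite lead_skewM => /eqP.
  by rewrite mulf_eq0 fmorph_eq0 !lead_coef_eq0 (negPf nz_u) (negPf nz_f).
by apply/esym/eqP; rewrite -subr_eq0 -/v -def_v u0 mul0r.
Qed.

Lemma skew_modp0 g : skew_modp g 0 = g.
Proof. by rewrite [RHS](skew_divp_eq g 0) mulr0 add0r. Qed.

Lemma skew_modpD g h f : skew_modp (g + h) f = skew_modp g f + skew_modp h f.
Proof.
have [->|nz_f] := eqVneq f 0; first by rewrite !skew_modp0.
apply: (@skew_modp_uniq _ _ (skew_divp g f + skew_divp h f)).
  by rewrite mulrDl addrACA -!skew_divp_eq.
by rewrite (leq_ltn_trans (size_polyD _ _)) // gtn_max !size_skew_modp.
Qed.

Lemma skew_modpCM c g f : skew_modp (skewC c * g) f = skewC c * skew_modp g f.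
Proof.
have [->|nz_f] := eqVneq f 0; first by rewrite !skew_modp0.
apply: (@skew_modp_uniq _ _ (skewC c * skew_divp g f)).
  by rewrite -mulrA -mulrDr -skew_divp_eq.
apply: leq_ltn_trans (size_skew_modp g nz_f).
by apply/leq_sizeP => k le_k; rewrite coef_skewCM nth_default ?mulr0.
Qed.

End SkewPoly.

(* The F-vector space of the polynomials of degree less than deg f.           *)
Definition petit_space (F : fieldType) (K : fieldExtType F) (s : 'AEnd(K))
  (f : skew_poly s) := {poly_(size f).-1 K}.

Section Petit.

Variables (F : fieldType) (K : fieldExtType F) (s : 'AEnd(K)).
Variable f : skew_poly s.
Local Notation V := (petit_space f).
Implicit Types (g h : V).

HB.instance Definition _ := GRing.Zmodule.copy V {poly_(size f).-1 K}.

Definition petit_scale (c : F) g : V :=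
  c%:A *: (g : {poly_(size f).-1 K}).

Fact petit_scaleA a b g : petit_scale a (petit_scale b g) = petit_scale (a * b) g.
Proof. by rewrite /petit_scale scalerA -scalerAl mul1r scalerA. Qed.

Fact petit_scale1 : left_id 1 petit_scale.
Proof. by move=> g; rewrite /petit_scale !scale1r. Qed.

Fact petit_scaleDr : right_distributive petit_scale +%R.
Proof. by move=> c g h; rewrite /petit_scale scalerDr. Qed.

Fact petit_scaleDl g : {morph petit_scale^~ g : a b / a + b}.
Proof. by move=> a b; rewrite /petit_scale !scalerDl. Qed.

HB.instance Definition _ := GRing.Zmodule_isLmodule.Build F V
  petit_scaleA petit_scale1 petit_scaleDr petit_scaleDl.

(* Only the case f = 0 needs npolyp to truncate anything.                     *)
Definition petit_mul g h : V :=
  npolyp (size f).-1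
    (skew_modp ((polyn g : skew_poly s) * (polyn h : skew_poly s)) f).

Lemma petit_mulE g h : f != 0 ->
  polyn (petit_mul g h) =
    skew_modp ((polyn g : skew_poly s) * (polyn h : skew_poly s)) f.
Proof.
move=> nz_f; rewrite npolypK // -ltnS prednK ?size_skew_modp //.
by rewrite size_poly_gt0.
Qed.

Lemma polyn_petit_scale (c : F) g :
  polyn (c *: g) = skewC s c%:A * (polyn g : skew_poly s) :> skew_poly s.
Proof. by apply/polyP=> k; rewrite coef_skewCM -coefZ. Qed.

Lemma skew_mulFC (c : F) (p q : skew_poly s) :
  p * (skewC s c%:A * q) = skewC s c%:A * (p * q).
Proof.
apply/polyP=> k; rewrite coef_skewCM !coef_skewM big_distrr /=.
apply: eq_bigr => i _; rewrite coef_skewCM rmorphM mulrCA; congr (_ * _).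
by elim: (i : nat) => //= j ->; rewrite linearZ /= rmorph1.
Qed.

Fact npolyp_skewP (c : F) (p q : skew_poly s) :
  npolyp (size f).-1 (skewC s c%:A * p + q : skew_poly s) =
    c *: (npolyp (size f).-1 p : V) + (npolyp (size f).-1 q : V) :> V.
Proof.
apply/val_inj/polyP=> k /=; rewrite [RHS]coefD coefZ !coef_npolyp.
by case: ifP => _; rewrite ?mulr0 ?addr0 // coefD coef_skewCM.
Qed.

Fact petit_mul_linearl h : linear (petit_mul^~ h).
Proof.
move=> c g1 g2; rewrite /petit_mul -npolyp_skewP; congr npolyp.
have ->: polyn (c *: g1 + g2) =
    skewC s c%:A * (polyn g1 : skew_poly s) + (polyn g2 : skew_poly s).
  by rewrite -polyn_petit_scale.
by rewrite mulrDl -mulrA skew_modpD skew_modpCM.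
Qed.

Fact petit_mul_linearr g : linear (petit_mul g).
Proof.
move=> c h1 h2; rewrite /petit_mul -npolyp_skewP; congr npolyp.
have ->: polyn (c *: h1 + h2) =
    skewC s c%:A * (polyn h1 : skew_poly s) + (polyn h2 : skew_poly s).
  by rewrite -polyn_petit_scale.
by rewrite mulrDr skew_mulFC skew_modpD skew_modpCM.
Qed.

Definition petit_one : V := npolyp (size f).-1 1.

Fact petit_mul_unit : (1 < size f)%N ->
  left_id petit_one petit_mul /\ right_id petit_one petit_mul.
Proof.
move=> f_gt1; have f_gt0 := ltnW f_gt1.
have one_val: polyn petit_one = (1 : skew_poly s).
  by rewrite npolypK // size_poly1 -ltnS prednK.
have modV g : npolyp (size f).-1 (skew_modp (polyn g : skew_poly s) f) = g.
  apply/val_inj; rewrite /= (@skew_modp_uniq _ _ _ _ f 0 (polyn g)).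
  - by rewrite npolypK // size_npoly.
  - by rewrite mul0r add0r.
  by apply: (leq_ltn_trans (size_npoly g)); rewrite prednK.
by split=> g; rewrite /petit_mul one_val ?mul1r ?mulr1 modV.
Qed.

Definition petit : naAlg F := NAAlg petit_mul_linearl petit_mul_linearr.

End Petit.

(* The class of the algebras K[t; s] / K[t; s](t^m - a), a in K \ F.          *)
Definition petit_class (F : fieldType) (K : splittingFieldType F) (m : nat)
    (s : gal_of {:K}) (A : naAlg F) : Prop :=
  exists2 a : K, a \notin 1%VS & A = petit (skewt s ^+ m - skewC s a).

(* Main.v *)
From HB Require Import structures.
Require Import Defs.
From mathcomp Require Import all_boot all_order all_fingroup all_algebra.
From mathcomp Require Import all_solvable all_field zify.

Set Implicit Arguments.
Unset Strict Implicit.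
Unset Printing Implicit Defensive.

Import GRing.Theory.
Local Open Scope ring_scope.

(** The count of the generators is the count of the generators of a cyclic
    group of order [\dim {:K} = n]. Properness comes from bracketing the
    power t^(m + 1) in two ways: (t t^(m-1)) t = a t, while
    t (t^(m-1) t) = s(a) t, and s(a) <> a because only F is fixed by a
    generator s.

    The point is that an isomorphism [G] from K[t; s1]/(t^m - a1) to
    K[t; s2]/(t^m - a2) forces s1 = s2. The left nucleus of such an algebra is
    K ([petit_const_left_nucleus], [petit_left_nucleus]), so [G] restricts to
    an automorphism [tau] of K ([petit_iso_const]), which commutes with s1
    since the Galois group is abelian. Applying [G] to t c = s1(c) t shows that
    [G] maps t to a combination of the t^i with s2^i = s1
    ([petit_iso_weight]). As m - 1 <= n and s1 <> 1, only one exponent j < m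
    qualifies, so G(t) = k t^j; it remains to rule out j > 1.

    This is [monomial_iso_fixed]. Suppose j > 1 and write u = k t^j. Let q be
    the least integer with q j >= m, and r = q j - m < j. The power u^q is the
    first one that wraps around the relation t^m = a2, so it is
    a multiple of t^r. As j > 1, we have q < m, so in the source algebra the
    products t^q t and t t^q agree. On the one hand, commuting u^q past
    constants gives s2^r = s1^q = s2^(q j), whence s2^m = 1. On the other
    hand, u^q u = u u^q compares s2^r(a2) with s2^(j + r)(a2), all the factors
    that involve k cancelling because s2^m = 1. So s1 = s2^j fixes a2, which
    contradicts that a2 is not in F. That different generators have different
    classes follows, since the identity is an isomorphism. *)

(** * The product of K[t; s]/(t^m - a) in coordinates *)

Definition left_nucleus (F : fieldType) (A : naAlg F) (x : A) : Prop :=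
  forall y z, na_mul x (na_mul y z) = na_mul (na_mul x y) z.

Section PureMonomialModulus.

Variables (F : fieldType) (K : fieldExtType F) (s : 'AEnd(K)).

Lemma iter_aend_inj i : injective (iter i s).
Proof. exact: (@fmorph_inj _ _ (iter i s)). Qed.

Lemma coef_skewMXn (p : skew_poly s) i k :
  (p * ('X^i : skew_poly s))`_k = if (i <= k)%N then p`_(k - i) else 0.
Proof.
rewrite coef_skewM; have [le_ik | lt_ki] := leqP i k; last first.
  rewrite big1 // => j _; rewrite coefXn.
  case: eqP => [kj | _]; last by rewrite rmorph0 mulr0.
  by move: (ltn_ord j) kj lt_ki; lia.
have lt_k : (k - i < k.+1)%N by lia.
rewrite (bigD1 (Ordinal lt_k)) //= coefXn subKn // eqxx.
rewrite rmorph1 mulr1 big1 ?addr0 // => j ne_j; rewrite coefXn.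
case: eqP => [kj | _]; last by rewrite rmorph0 mulr0.
by case/eqP: ne_j; apply/val_inj; move: (ltn_ord j) kj => /=; lia.
Qed.

Lemma coef_skewMC (p : skew_poly s) c k :
  (p * skewC s c)`_k = p`_k * iter k s c.
Proof.
rewrite coef_skewM big_ord_recr /= subnn coefC eqxx big1 ?add0r // => j _.
rewrite coefC; case: eqP => [kj|_]; last by rewrite rmorph0 mulr0.
by move: (ltn_ord j) kj; lia.
Qed.

Variables (m : nat) (a : K).
Hypothesis m_gt0 : (0 < m)%N.

Local Notation f := (skewt s ^+ m - skewC s a).
Local Notation V := (petit_space f).

Lemma size_skewtXn_subC : size f = m.+1.
Proof. by rewrite skewtX /skewC; apply: size_XnsubC. Qed.

(** Writing [p = r + q t^m], one replaces [q t^m] by [q a], whose coefficients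
    are twisted since [a] stands on the right. If [size p <= 2 m], this single
    step already brings the degree below [m]. *)
Lemma coef_skew_modp (p : skew_poly s) k :
  (size p <= m + m)%N -> (k < m)%N ->
  (skew_modp p f)`_k = p`_k + p`_(k + m) * iter k s a.
Proof.
move=> le_p lt_k; pose q : skew_poly s := drop_poly m p.
pose r : skew_poly s := (take_poly m p : skew_poly s) + q * skewC s a.
rewrite (@skew_modp_uniq _ _ _ _ f q r).
- by rewrite coefD coef_skewMC coef_take_poly lt_k coef_drop_poly.
- rewrite mulrBr addrCA subrK; apply/polyP=> i.
  rewrite coefD skewtX coef_skewMXn coef_take_poly coef_drop_poly ltnNge.
  by case: leqP => [/subnK-> | _]; rewrite ?add0r ?addr0.
rewrite size_skewtXn_subC ltnS; apply/leq_sizeP=> i le_mi.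
rewrite coefD coef_skewMC coef_take_poly ltnNge le_mi coef_drop_poly.
rewrite /= add0r nth_default ?mul0r //.
by apply: leq_trans le_p _; rewrite leq_add2r.
Qed.

Lemma size_petit (x : V) : (size (polyn x) <= m)%N.
Proof. by apply: leq_trans (size_npoly x) _; rewrite size_skewtXn_subC. Qed.

Lemma coef_petit_ge (x : V) k : (m <= k)%N -> (polyn x)`_k = 0.
Proof.
by move=> le_mk; rewrite nth_default //; apply: leq_trans (size_petit x) _.
Qed.

Lemma petit_space_eqP (x y : V) :
  (forall k, (k < m)%N -> (polyn x)`_k = (polyn y)`_k) -> x = y.
Proof.
move=> eq_xy; apply/npolyP => k; have [/eq_xy//|le_mk] := ltnP k m.
by rewrite !coef_petit_ge.
Qed.

Lemma coef_petit_mul (x y : V) k : (k < m)%N ->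
  (polyn (petit_mul x y))`_k =
    ((polyn x : skew_poly s) * (polyn y : skew_poly s))`_k
    + ((polyn x : skew_poly s) * (polyn y : skew_poly s))`_(k + m)
      * iter k s a.
Proof.
have nz_f : f != 0 by rewrite -size_poly_gt0 size_skewtXn_subC.
move=> lt_k; rewrite petit_mulE //.
apply: coef_skew_modp => //.
apply: (leq_trans (size_poly _ _)); apply: leq_trans (leq_pred _) _.
exact: leq_add (size_petit x) (size_petit y).
Qed.

Definition petit_mono (c : K) (i : nat) : V :=
  npolyp (size f).-1 (c *: 'X^i).

Lemma coef_petit_mono c i k : (i < m)%N ->
  (polyn (petit_mono c i))`_k = c *+ (k == i).
Proof.
move=> lt_i; rewrite coef_npolyp size_skewtXn_subC /= coefZ coefXn.
case: ltnP => [_|le_mk]; first by rewrite mulr_natr.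
by case: eqP => // eq_ki; move: lt_i le_mk; lia.
Qed.

Lemma petit_mono_inj i : (i < m)%N -> injective (petit_mono^~ i).
Proof.
move=> lt_i c d /(congr1 (fun x : V => (polyn x)`_i)).
by rewrite !coef_petit_mono // eqxx.
Qed.

Lemma petit_mono_linear i : linear (petit_mono^~ i : K -> V).
Proof.
move=> c u v; apply/npolyP => k /=.
rewrite !coefD coefZ !coef_npolyp !coefZ.
by case: ifP => _; rewrite ?mulr0 ?addr0 // mulrDl -scalerAl -!scalerAl mul1r.
Qed.

Lemma petit_mono_skew c i : (i < m)%N ->
  polyn (petit_mono c i) = skewC s c * ('X^i : skew_poly s) :> skew_poly s.
Proof.
move=> lt_i; apply/polyP => k.
by rewrite coef_petit_mono // coef_skewCM coefXn mulr_natr.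
Qed.

Lemma coef_petitMC (x : V) c k : (k < m)%N ->
  (polyn (petit_mul x (petit_mono c 0)))`_k = (polyn x)`_k * iter k s c.
Proof.
move=> lt_k; rewrite coef_petit_mul // petit_mono_skew //.
rewrite expr0 (mulr1 (skewC s c)) !coef_skewMC.
by rewrite (@coef_petit_ge x (k + m)) ?mul0r ?addr0 // leq_addl.
Qed.

Lemma coef_petitCM (x : V) c k : (k < m)%N ->
  (polyn (petit_mul (petit_mono c 0) x))`_k = c * (polyn x)`_k.
Proof.
move=> lt_k; rewrite coef_petit_mul // petit_mono_skew //.
rewrite expr0 (mulr1 (skewC s c)) !coef_skewCM.
by rewrite (@coef_petit_ge x (k + m)) ?mulr0 ?mul0r ?addr0 // leq_addl.
Qed.

Lemma petit_const_left_nucleus c :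
  left_nucleus (petit_mono c 0 : petit f).
Proof.
move=> y z; apply: petit_space_eqP => k lt_k /=; rewrite coef_petitCM //.
have def_cy : polyn (petit_mul (petit_mono c 0) y)
    = skewC s c * (polyn y : skew_poly s) :> skew_poly s.
  apply/polyP=> i; rewrite coef_skewCM; have [lt_i|le_i] := ltnP i m.
    by rewrite coef_petitCM.
  by rewrite !coef_petit_ge ?mulr0.
by rewrite !coef_petit_mul // def_cy -!(mulrA (skewC s c)) !coef_skewCM
  mulrDr -!mulrA.
Qed.

(** For [e < 2 m], the power t^e reduces to [carry e] t^(e mod m), because
    t^(e - m) t^m = t^(e - m) a = s^(e - m)(a) t^(e - m). *)
Definition carry (e : nat) : K := if (e < m)%N then 1 else iter (e - m) s a.

Lemma petit_mono_mul c d i j : (i < m)%N -> (j < m)%N ->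
  petit_mul (petit_mono c i) (petit_mono d j) =
    petit_mono (c * iter i s d * carry (i + j)) ((i + j) %% m).
Proof.
move=> lt_i lt_j; apply: petit_space_eqP => k lt_k.
rewrite coef_petit_mono ?ltn_mod // coef_petit_mul // !petit_mono_skew //.
have coefE l : (skewC s c * ('X^i : skew_poly s) *
     (skewC s d * ('X^j : skew_poly s)))`_l =
     (c * iter i s d) *+ (l == i + j)%N.
  rewrite -mulrA coef_skewCM coef_skewXnM coef_skewCM coefXn mulr_natr.
  case: leqP => [le_il | lt_li]; last first.
    by rewrite mulr0; case: eqP => // def_l; move: lt_li def_l; lia.
  have -> : (l == i + j)%N = (l - i == j)%N by move: le_il; lia.
  by case: eqP => _; rewrite ?rmorph0 ?mulr0.
rewrite !coefE /carry; case: ltnP => [lt_ij | le_ij].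
  rewrite modn_small // mulr1 (_ : (k + m == _)%N = false) ?mul0r ?addr0 //.
  by move: lt_ij; lia.
have -> : ((i + j) %% m = i + j - m)%N.
  by rewrite -{1}(subnK le_ij) modnDr modn_small //; move: lt_i lt_j; lia.
have -> : (k == i + j)%N = false by move: le_ij lt_k; lia.
have -> : (k + m == i + j)%N = (k == i + j - m)%N by move: le_ij; lia.
by rewrite add0r; case: eqP => [->|]; rewrite ?mul0r.
Qed.

End PureMonomialModulus.

(** * The left nucleus, and the failure of associativity *)

Section LeftNucleus.

Variables (F : fieldType) (K : fieldExtType F) (s : 'AEnd(K)) (m : nat) (a : K).
Hypothesis m_gt1 : (1 < m)%N.
Hypothesis sa : s a != a.

Local Notation f := (skewt s ^+ m - skewC s a).
Local Notation V := (petit_space f).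
Local Notation E := (petit_mono s m a).
Let m_gt0 : (0 < m)%N := ltnW m_gt1.

Lemma petit_t_power : petit_mul (E 1 m.-1) (E 1 1) = E a 0.
Proof.
have lt1 : (m.-1 < m)%N by rewrite prednK.
rewrite petit_mono_mul // addn1 prednK // modnn /carry ltnn subnn /=.
by rewrite rmorph1 !mul1r.
Qed.

(** One test suffices: compare [x (t^(m-1) t) = x a] with [(x t^(m-1)) t].
    In the latter, for [k > 0], the coefficient of t^k is multiplied by
    s^(k - 1)(a), since the reduction takes place before the last
    multiplication by t, and in the former by s^k(a). *)
Lemma petit_left_nucleus (x : petit f) :
  left_nucleus x -> x = E (polyn (x : V))`_0 0.
Proof.
move=> nuc_x; apply: petit_space_eqP => // k lt_k.
rewrite coef_petit_mono //; case: k lt_k => [//|k] lt_k; rewrite mulr0n.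
have := nuc_x (E 1 m.-1) (E 1 1).
rewrite /= petit_t_power => /(congr1 (fun x : V => (polyn x)`_k.+1)).
rewrite coef_petitMC // coef_petit_mul //.
have mul_t (y : V) l :
    ((polyn y : skew_poly s) * (polyn (E 1 1) : skew_poly s))`_l
  = if (0 < l)%N then (polyn y)`_l.-1 else 0.
  by rewrite petit_mono_skew // (mul1r ('X^1 : skew_poly s)) coef_skewMXn subn1.
rewrite !mul_t /= (@coef_petit_ge _ _ _ _ _ _ _ (k + m)) ?leq_addl //.
rewrite mul0r addr0 coef_petit_mul ?(ltnW lt_k) //.
rewrite petit_mono_skew ?prednK // (mul1r ('X^_ : skew_poly s)) !coef_skewMXn.
have lt_km : (m.-1 <= k + m)%N by lia.
have -> : (m.-1 <= k)%N = false by move: lt_k; lia.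
rewrite lt_km (_ : (k + m - m.-1 = k.+1)%N); last by move: m_gt0; lia.
rewrite add0r => /eqP; rewrite -subr_eq0 -mulrBr mulf_eq0 => /orP[/eqP //|].
by rewrite subr_eq0 -iterS iterSr => /eqP/iter_aend_inj/eqP; rewrite (negPf sa).
Qed.

Lemma petit_proper : na_proper (petit f).
Proof.
move=> assoc; have := assoc (E 1 1) (E 1 m.-1) (E 1 1).
have lt1 : (m.-1 < m)%N by rewrite prednK.
rewrite /= petit_t_power !petit_mono_mul ?ltn_mod // addn0 add1n prednK //.
rewrite modnn add0n /carry !modn_small // m_gt1 ltnn subnn /=.
rewrite rmorph1 !mulr1 !mul1r => /(petit_mono_inj m_gt0 m_gt1) /eqP.
by rewrite (negPf sa).
Qed.

End LeftNucleus.

(** * Isomorphisms between two such algebras *)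

Lemma iso_left_nucleus (F : fieldType) (A B : naAlg F) (G : A -> B) :
  bijective G -> {morph G : x y / na_mul x y >-> na_mul x y} ->
  forall x, left_nucleus x -> left_nucleus (G x).
Proof.
move=> [H GK HK] GM x nuc_x y z.
by rewrite -[y]HK -[z]HK -!GM nuc_x.
Qed.

Section PetitIsomorphism.

Variables (F : fieldType) (K : fieldExtType F) (s1 s2 : 'AEnd(K)).
Variables (m : nat) (a1 a2 : K).
Hypotheses (m_gt1 : (1 < m)%N) (s2a2 : s2 a2 != a2).

Let m_gt0 : (0 < m)%N := ltnW m_gt1.
Local Notation A1 := (petit (skewt s1 ^+ m - skewC s1 a1)).
Local Notation A2 := (petit (skewt s2 ^+ m - skewC s2 a2)).
Local Notation E1 := (petit_mono s1 m a1).
Local Notation E2 := (petit_mono s2 m a2).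
Local Notation coef x i :=
  (polyn (x : petit_space (skewt s2 ^+ m - skewC s2 a2)))`_i.

Variable G : {linear A1 -> A2}.
Hypothesis G_bij : bijective G.
Hypothesis GM : {morph G : x y / na_mul x y >-> na_mul x y}.

Lemma petit_iso_const :
  exists2 tau : 'End(K), kHom 1 fullv tau
    & forall c, G (E1 c 0 : A1) = E2 (tau c) 0.
Proof.
pose g c := coef (G (E1 c 0%N : A1)) 0.
have Gg c : G (E1 c 0%N : A1) = E2 (g c) 0.
  apply: petit_left_nucleus => //; apply: (iso_left_nucleus G_bij GM).
  exact: petit_const_left_nucleus.
have g_lin : linear g.
  move=> c u v; apply: (petit_mono_inj (s := s2) (a := a2) m_gt0 m_gt0).
  rewrite petit_mono_linear /= -!Gg petit_mono_linear.
  exact: (linearP G).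
have gM u v : g (u * v) = g u * g v.
  apply: (petit_mono_inj (s := s2) (a := a2) m_gt0 m_gt0); rewrite /= -Gg.
  have E0M s a (c d : K) : petit_mono s m a (c * d) 0 =
      petit_mul (petit_mono s m a c 0) (petit_mono s m a d 0).
    by rewrite petit_mono_mul // /carry m_gt0 mulr1 mod0n.
  by rewrite !E0M -!Gg; apply: GM.
pose gL : {linear K -> K} :=
  HB.pack g (GRing.isLinear.Build F K K *:%R g g_lin).
have g0 : g 0 = 0 by apply: (linear0 gL).
have nz_g1 : g 1 != 0.
  rewrite -g0; apply: contra_neq (oner_neq0 K) => eq_g.
  apply: (petit_mono_inj (s := s1) (a := a1) m_gt0 m_gt0).
  by apply: (bij_inj G_bij); rewrite !Gg eq_g.
have g1 : g 1 = 1 by apply: (mulfI nz_g1); rewrite -gM !mulr1.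
exists (linfun gL) => [|c]; last by rewrite lfunE.
apply/kHomP_tmp; split=> [x|x y _ _]; last by rewrite !lfunE /= gM.
case/vlineP=> c ->; rewrite lfunE linearZ /=; congr (_ *: _); exact: g1.
Qed.

Variable tau : 'End(K).
Hypothesis tau_kHom : kHom 1 fullv tau.
Hypothesis G_const : forall c, G (E1 c 0%N : A1) = E2 (tau c) 0.

(** The image under [G] of t^q c = s1^q(c) t^q, read off at t^i. *)
Lemma petit_iso_weight q i c : (q < m)%N -> (i < m)%N ->
  let x := coef (G (E1 1 q : A1)) i in
  x * iter i s2 (tau c) = tau (iter q s1 c) * x.
Proof.
move=> lt_q lt_i /=; rewrite -coef_petitMC // -coef_petitCM // -!G_const.
congr (coef _ i); rewrite -[LHS]GM -[RHS]GM; congr (G _) => /=.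
rewrite !petit_mono_mul // addn0 add0n modn_small // /carry lt_q /=.
by rewrite mul1r !mulr1.
Qed.

Lemma kHom_full_surj y : exists x, y = tau x.
Proof.
have : kAut 1 {:K} tau by rewrite kAutE tau_kHom subvf.
by case/andP=> _ /eqP def_K; have /memv_imgP[x _ ->] : y \in (tau @: fullv)%VS;
   [rewrite def_K memvf | exists x].
Qed.

Lemma petit_mono_commute i : (i < m)%N ->
  petit_mul (E1 1 i) (E1 1 1) = petit_mul (E1 1 1) (E1 1 i).
Proof. by move=> lt_i; rewrite !petit_mono_mul // !rmorph1 addnC. Qed.

Lemma petit_mono_succ i : (i.+1 < m)%N ->
  E1 1 i.+1 = petit_mul (E1 1 1) (E1 1 i).
Proof.
move=> lt_i; rewrite petit_mono_mul ?(ltnW lt_i) // rmorph1 add1n.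
by rewrite /carry lt_i modn_small // !mulr1.
Qed.

(** As long as [p * j < m], computing the [p]th power of [k t^j] needs no
    reduction modulo t^m - a2. *)
Lemma monomial_iso_pow k j p :
    G (E1 1 1 : A1) = E2 k j -> k != 0 -> (0 < j)%N ->
    (0 < p)%N -> (p * j < m)%N ->
  exists2 c, c != 0 & G (E1 1 p : A1) = E2 c (p * j).
Proof.
move=> Gt nz_k j_gt0; elim: p => // -[_ _ _|p IHp _ lt_pj].
  by exists k => //; rewrite mul1n.
have lt_j : (j < m)%N by move: lt_pj; rewrite mulSn; lia.
have lt_pj1 : (p.+1 * j < m)%N by move: lt_pj; rewrite mulSn; lia.
have [//|c nz_c Gp] := IHp isT.
exists (k * iter j s2 c); first by rewrite mulf_neq0 ?fmorph_eq0.
have lt_p : (p.+2 < m)%N by move: lt_pj; nia.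
rewrite petit_mono_succ //; have := GM (E1 1 1) (E1 1 p.+1); rewrite /= => ->.
rewrite Gt Gp /= petit_mono_mul // -mulSn /carry lt_pj.
by rewrite modn_small // mulr1.
Qed.

(** The power [q = p + 1] of [k t^j] is the first one that wraps around the
    relation t^m = a2; a factor s2^r(a2) then appears, which the multiplication
    by [k t^j] on the left twists by s2^j, but not the one on the right. *)
Lemma monomial_iso_fixed k j :
    G (E1 1 1 : A1) = E2 k j -> k != 0 -> (1 < j)%N -> (j < m)%N ->
  iter j s2 a2 = a2.
Proof.
move=> Gt nz_k j_gt1 lt_j; pose p := (m.-1 %/ j)%N.
have j_gt0 : (0 < j)%N := ltnW j_gt1.
have p_gt0 : (0 < p)%N by rewrite divn_gt0 // -ltnS prednK.
have lt_pj : (p * j < m)%N.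
  by rewrite -(prednK m_gt0) ltnS; apply: leq_divM.
have le_m : (m <= p.+1 * j)%N.
  by rewrite -[m in (m <= _)%N](prednK m_gt0) -ltn_divLR.
(* Here [j > 1] matters: p + 1 <= 2 p <= p j < m. *)
have lt_p : (p.+1 < m)%N by move: lt_pj; clear -p_gt0 j_gt1; nia.
have nz_a : a2 != 0 by apply: contraNneq s2a2 => ->; rewrite rmorph0.
have [c nz_c Gp] := monomial_iso_pow Gt nz_k j_gt0 p_gt0 lt_pj.
pose r := (p.+1 * j - m)%N; have def_rm : (r + m = p.+1 * j)%N := subnK le_m.
pose S i := iter i s2.
have lt_r : (r < m)%N by rewrite /r; move: lt_pj lt_j; rewrite mulSn; lia.
have mod_r : ((j + p * j) %% m = r)%N.
  by rewrite -mulSn -(subnK le_m) modnDr modn_small.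
have carry_r : carry s2 m a2 (j + p * j) = S r a2.
  by rewrite /carry -mulSn ltnNge le_m.
pose e := k * S j c * S r a2.
have Gq : G (E1 1 p.+1 : A1) = E2 e r.
  rewrite petit_mono_succ //; have := GM (E1 1 1) (E1 1 p); rewrite /= => ->.
  by rewrite Gt Gp /= petit_mono_mul // mod_r carry_r.
(* The two ways of computing u^(p + 1), as u u^p and as u^p u. *)
have def_e : k * S j c = c * S (p * j)%N k.
  have /(congr1 G) := petit_mono_commute (ltnW lt_p).
  have := GM (E1 1 1) (E1 1 p); have := GM (E1 1 p) (E1 1 1) => /= -> ->.
  rewrite Gt Gp /= !petit_mono_mul // [(_ + j)%N]addnC mod_r carry_r.
  move/(petit_mono_inj m_gt0 lt_r)/mulIf => -> //.
  by rewrite fmorph_eq0.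
(* The reduction factor of t^(r + j) is the same on both sides. *)
have comm_e : k * S j e = e * S r k.
  have /(congr1 G) := petit_mono_commute lt_p.
  have := GM (E1 1 1) (E1 1 p.+1); have := GM (E1 1 p.+1) (E1 1 1) => /= -> ->.
  rewrite Gt Gq /= !petit_mono_mul // [(_ + j)%N]addnC.
  move/(petit_mono_inj m_gt0 (ltn_pmod _ m_gt0))/mulIf => -> //.
  by rewrite /carry; case: ifP => _; rewrite ?oner_eq0 ?fmorph_eq0.
have nz_e : e != 0 by rewrite !mulf_neq0 ?fmorph_eq0.
have wt_j y : S j (tau y) = tau (s1 y).
  have := petit_iso_weight y m_gt1 lt_j.
  rewrite /= Gt coef_petit_mono // eqxx mulrC => /mulIf; exact.
have wt_r y : S r (tau y) = tau (iter p.+1 s1 y).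
  have := petit_iso_weight y lt_p lt_r.
  rewrite /= Gq coef_petit_mono // eqxx mulrC => /mulIf; exact.
have wt_ij i y : S (i * j)%N (tau y) = tau (iter i s1 y).
  elim: i y => //= i IHi y; rewrite mulSn addnC /S iterD -/(S j _) wt_j.
  by rewrite -/(S _ _) IHi -iterSr.
(* Both s2^r and s2^(r + m) act on the image of tau as s1^(p + 1). *)
have sm_id y : S m y = y.
  have [x ->] := kHom_full_surj y; apply: (@iter_aend_inj _ _ s2 r).
  by rewrite /S -iterD def_rm -!/(S _ _) wt_ij wt_r.
have Sjk : S j (S (p * j)%N k) = S r k.
  rewrite /S -iterD -mulSn -def_rm iterD.
  by congr (iter _ _ _); apply: sm_id.
have nz_c' : k * S j c * S r k != 0 by rewrite !mulf_neq0 ?fmorph_eq0.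
apply: (@iter_aend_inj _ _ s2 r); rewrite -iterD addnC iterD.
apply: (mulfI nz_c'); transitivity (k * S j e).
  by rewrite /e {2}def_e -Sjk /S !rmorphM /= !mulrA.
by rewrite comm_e /e mulrAC.
Qed.

End PetitIsomorphism.

(** * Generators of a cyclic Galois group *)

Section CyclicGalois.

Variables (F : fieldType) (K : splittingFieldType F).
Local Notation Gal := 'Gal({:K}%AS / 1%AS)%g.
Implicit Types s : gal_of {:K}.

Lemma gal_iter s i c : (s ^+ i)%g c = iter i s c.
Proof.
elim: i => [|i IHi]; first by rewrite expg0 gal_id.
by rewrite expgSr galM ?memvf //= IHi.
Qed.

Lemma gal_iterP s s' i : (forall c, iter i s c = s' c) -> (s ^+ i)%g = s'.
Proof. by move=> eq_c; apply/eqP/gal_eqP=> c _; rewrite gal_iter. Qed.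

Hypothesis galK : galois 1%AS {:K}%AS.

Lemma order_gal_generator s : generator Gal s -> #[s]%g = \dim {:K}.
Proof.
by move=> /eqP gen_s; rewrite /order -gen_s -galois_dim // dimv1 divn1.
Qed.

Lemma gal_generator_fixed s a : generator Gal s -> s a = a -> a \in 1%VS.
Proof.
move=> /eqP gen_s sa; have /galois_fixedField {1}<- := galK.
apply/fixedFieldP; rewrite ?memvf // => x; rewrite gen_s => /cycleP[i ->].
by rewrite gal_iter; elim: i => //= i ->.
Qed.

(** The coefficient of t^i in [G t] can be nonzero only if s2^i = s1, which
    leaves one exponent j; it is not 1 as s1 <> s2, and if it were larger
    [monomial_iso_fixed] would put [a2] in the fixed field of s1. *)
Lemma petit_generators_not_iso (m : nat) s1 s2 (a1 a2 : K) :
    (1 < m)%N -> (m.-1 <= \dim {:K})%N ->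
    generator Gal s1 -> generator Gal s2 -> s1 != s2 -> s1 != 1%g ->
    a2 \notin 1%VS ->
  ~ na_isomorphic (petit (skewt s1 ^+ m - skewC s1 a1))
                  (petit (skewt s2 ^+ m - skewC s2 a2)).
Proof.
move=> m_gt1 le_m gen1 gen2 neq_s s1_neq1 a2_nF [G [G_bij GM]].
have m_gt0 := ltnW m_gt1.
have s2a2 : s2 a2 != a2.
  by apply: contraNneq a2_nF; apply: gal_generator_fixed.
have [tau tau_kHom G_const] := petit_iso_const m_gt1 s2a2 G_bij GM.
have [w w_Gal tauE] : {w | w \in Gal & {in {:K}%VS, tau =1 w}}.
  by apply: kAut_to_gal; rewrite kAutE tau_kHom subvf.
have comm_w : commute w s1.
  move/eqP: gen1 => gen1; apply: (centsP (cycle_abelian s1)).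
    by rewrite -gen1.
  exact: cycle_id.
pose u : petit_space (skewt s2 ^+ m - skewC s2 a2) :=
  G (petit_mono s1 m a1 1 1).
have wt_u i : (i < m)%N -> (polyn u)`_i != 0 -> (s2 ^+ i)%g = s1.
  move=> lt_i nz_ui; apply: gal_iterP => y.
  have [x ->] := kHom_full_surj tau_kHom y.
  have /= := petit_iso_weight m_gt1 GM G_const x m_gt1 lt_i.
  rewrite -/u mulrC => /(mulIf nz_ui) ->.
  by rewrite !tauE ?memvf // -!galM ?memvf // comm_w.
have nz_u : u != 0.
  have nz_t : petit_mono s1 m a1 1 1 != 0.
    apply/eqP => /(congr1 (fun x : petit_space _ => (polyn x)`_1)).
    by rewrite coef_petit_mono // coef0; apply/eqP/oner_neq0.
  by rewrite /u -(linear0 G) (inj_eq (bij_inj G_bij)).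
have [j lt_j nz_uj] : exists2 j, (j < m)%N & (polyn u)`_j != 0.
  case: (altP (@existsP _ (fun j : 'I_m => (polyn u)`_j != 0))) => [[j nz_uj]|].
    by exists j.
  rewrite negb_exists => /forallP u0; case/eqP: nz_u.
  apply: petit_space_eqP => // k lt_k; have := u0 (Ordinal lt_k).
  by rewrite negbK coef0 => /eqP.
have def_s1 := wt_u _ lt_j nz_uj.
have nz_expo i : (s2 ^+ i)%g = s1 -> (0 < i)%N.
  by case: i => // eq1; rewrite -eq1 expg0 eqxx in s1_neq1.
(* The exponents 1, ..., m - 1 are distinct modulo n because m - 1 <= n;
   the exponent 0, congruent to n, is excluded by s1 <> 1. *)
have uniq_j i : (i < m)%N -> (polyn u)`_i != 0 -> i = j.
  move=> lt_i /(wt_u _ lt_i) def_i.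
  have /eqP : (s2 ^+ i)%g = (s2 ^+ j)%g by rewrite def_i.
  rewrite eq_expg_mod_order order_gal_generator // => /eqP eq_ij.
  have := nz_expo _ def_i; have := nz_expo _ def_s1.
  move: eq_ij lt_i lt_j le_m; case: (i) (j) => [|i'] [|j'] //.
  move/eqP; rewrite -[i'.+1]addn1 -[j'.+1]addn1 eqn_modDr.
  move=> /eqP eq_ij lti ltj le_m _ _; move: eq_ij.
  rewrite !modn_small => [->//||]; move: lti ltj le_m; clear; lia.
have Gt : G (petit_mono s1 m a1 1 1) = petit_mono s2 m a2 (polyn u)`_j j.
  apply: petit_space_eqP => // k lt_k; rewrite -/u coef_petit_mono //.
  case: eqP => [->//|neq_kj]; apply/eqP; apply: contra_notT neq_kj.
  exact: uniq_j.
have j_gt1 : (1 < j)%N.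
  case: (j) def_s1 (nz_expo _ def_s1) => [|[|j']] //.
  by rewrite expg1 => eq_s _; rewrite eq_s eqxx in neq_s.
have := monomial_iso_fixed m_gt1 s2a2 GM tau_kHom G_const Gt nz_uj j_gt1 lt_j.
rewrite -gal_iter def_s1 => /(gal_generator_fixed gen1).
exact/negP.
Qed.

End CyclicGalois.

Theorem corollary3p4 (F : fieldType) (K : splittingFieldType F) (n m : nat)
    (galK : galois 1%AS {:K}%AS) (cycK : cyclic 'Gal({:K}%AS / 1%AS)%g)
    (dimK : \dim {:K} = n) (n_ge3 : (3 <= n)%N) (m_gt1 : (1 < m)%N)
    (le_m_n : (m - 1 <= n)%N) :
  [/\ #|[set s : gal_of {:K} | generator 'Gal({:K}%AS / 1%AS)%g s]| = totient n,
      forall s1 s2 : gal_of {:K},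
        generator 'Gal({:K}%AS / 1%AS)%g s1 ->
        generator 'Gal({:K}%AS / 1%AS)%g s2 ->
        petit_class m s1 = petit_class m s2 -> s1 = s2,
      forall s : gal_of {:K}, generator 'Gal({:K}%AS / 1%AS)%g s ->
        (exists A, petit_class m s A) /\
        (forall A, petit_class m s A -> na_proper A)
    & forall s1 s2 : gal_of {:K},
        generator 'Gal({:K}%AS / 1%AS)%g s1 ->
        generator 'Gal({:K}%AS / 1%AS)%g s2 ->
        s1 != s2 ->
        forall A1 A2, petit_class m s1 A1 -> petit_class m s2 A2 ->
          ~ na_isomorphic A1 A2].
Proof.
have not_iso (s1 s2 : gal_of {:K}) :
    generator 'Gal({:K}%AS / 1%AS)%g s1 ->
    generator 'Gal({:K}%AS / 1%AS)%g s2 -> s1 != s2 ->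
    forall A1 A2, petit_class m s1 A1 -> petit_class m s2 A2 ->
    ~ na_isomorphic A1 A2.
  move=> gen1 gen2 neq_s A1 A2 [a1 _ ->] [a2 a2_nF ->].
  apply: petit_generators_not_iso => //; first by rewrite dimK -subn1.
  rewrite -order_eq1 order_gal_generator // dimK.
  by move: n_ge3; case: (n) => [|[]].
have [a a_nF] : exists a : K, a \notin 1%VS.
  have /subvPn[a _ a_nF] : ~~ (fullv <= (1%VS : {vspace K}))%VS.
    by apply/negP => /dimvS; rewrite dimK dimv1; move: n_ge3; lia.
  by exists a.
have nonempty (s : gal_of {:K}) : exists A, petit_class m s A.
  by exists (petit (skewt s ^+ m - skewC s a)); exists a.
split=> // [|s1 s2 gen1 gen2 eq_class|s gen_s].
- have /cyclicP[g def_G] := cycK.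
  by rewrite def_G -totient_gen order_gal_generator ?dimK // def_G /generator.
- apply/eqP/negPn/negP => neq_s; have [A A_s1] := nonempty s1.
  apply: (not_iso _ _ gen1 gen2 neq_s A A A_s1); first by rewrite -eq_class.
  by exists idfun; split=> //; exists idfun.
split=> // A [b b_nF ->]; apply: petit_proper => //.
by apply: contraNneq b_nF; apply: gal_generator_fixed.
Qed.
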